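(* Let $X$ be a finite set with a metric $d$ and let $G$ be a finite group acting on $X$ from the right by isometries. Let $\mathcal{T}(X/G)=\{x_0,x_1,\ldots,x_{\ell-1}\}$ be a transversal of the orbits of $G$ on $X$ such that $\hat d(x_0G,x_iG)=d(x_0,x_i)$ for all $1\le i<\ell$, and let $\mathcal{C}=x_0G$ be the corresponding orbit code. Let $\gamma_{\mathcal{T}(X/G)}:X\to G$ be a canonizing mapping. Then the mapping $$\mathrm{dec}_{\mathcal{C}}:X\to\mathcal{C},\qquad r\mapsto x_0\,\gamma_{\mathcal{T}(X/G)}(r)^{-1}$$ is a minimum distance decoder, i.e. for every $r\in X$ the element $x_0\gamma_{\mathcal{T}(X/G)}(r)^{-1}\in\mathcal{C}$ is a closest codeword to $r$: $d(x_0\gamma_{\mathcal{T}(X/G)}(r)^{-1},r)\le d(c',r)$ for all $c'\in\mathcal{C}$.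
   Context: $G$ acts by isometries: $d(xg,x'g)=d(x,x')$ for all $x,x'\in X$, $g\in G$. The orbit of $x$ is $xG=\{xg\mid g\in G\}$, and $X/G$ is the set of orbits. A transversal $\mathcal{T}(X/G)$ is a set containing exactly one representative of each orbit. A canonizing mapping $\gamma_{\mathcal{T}(X/G)}:X\to G$ sends $x$ to a group element $g$ with $xg\in\mathcal{T}(X/G)$. For subsets $A,B\subseteq X$, $\hat d(A,B)=\min\{d(x,y)\mid x\in A,\,y\in B\}$. An orbit code is an orbit $xG$ regarded as a code in $X$. *)

(* Defs.v *)
From HB Require Import structures.
From mathcomp Require Import all_boot all_order all_fingroup all_algebra.
From mathcomp Require Import filter topology_structure uniform_structure.
From mathcomp Require Import reals pseudometric_structure metric_structure.

Set Implicit Arguments.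
Unset Strict Implicit.
Unset Printing Implicit Defensive.

Import Order.TTheory GRing.Theory Num.Theory.

Local Open Scope ring_scope.

#[short(type="finMetricType")]
HB.structure Definition FinMetric (K : numDomainType) :=
  { M of Metric K M & Finite M }.

Section Distance.
Variables (R : realType) (X : finMetricType R).
Implicit Types (A B C : {set X}).

(* The value is a minimum only when A and B are both nonempty; otherwise it is
   the junk value 0. *)
Definition set_mdist A B : R :=
  if [pick p in setX A B] is Some p0 then
    let p := [arg min_(q < p0 in setX A B) mdist q.1 q.2]%O in mdist p.1 p.2
  else 0.

Lemma set_mdist_attained A B a b : a \in A -> b \in B ->
  exists x y, [/\ x \in A, y \in B & set_mdist A B = mdist x y].
Proof.
move=> aA bB; rewrite /set_mdist; case: pickP => [p0 p0AB|/(_ (a, b))]; last first.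
  by rewrite inE /= aA bB.
case: arg_minP => //= p; rewrite inE => /andP[pA pB] _.
by exists p.1, p.2.
Qed.

Lemma set_mdist_le A B a b : a \in A -> b \in B -> set_mdist A B <= mdist a b.
Proof.
move=> aA bB; rewrite /set_mdist; case: pickP => [p0 p0AB|/(_ (a, b))]; last first.
  by rewrite inE /= aA bB.
by case: arg_minP => //= p _ /(_ (a, b)); apply; rewrite inE /= aA bB.
Qed.

Definition min_distance_decoder C (f : X -> X) : Prop :=
  forall r, f r \in C /\ forall c, c \in C -> mdist (f r) r <= mdist c r.

End Distance.

(* An action of MathComp is a right action: to x (g * h) = to (to x g) h. *)
Section Action.
Variables (R : realType) (X : finMetricType R) (G : finGroupType).
Variable to : {action G &-> X}.

Definition acts_by_isometries : Prop :=
  forall (x x' : X) (g : G), mdist (to x g) (to x' g) = mdist x x'.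

Definition orbit_set : {set {set X}} := orbit to [set: G] @: [set: X].

Definition orbit_code (x0 : X) : {set X} := orbit to [set: G] x0.

Definition canonizing (T : {set X}) (gamma : X -> G) : Prop :=
  forall x, to x (gamma x) \in T.

Definition dec (x0 : X) (gamma : X -> G) (r : X) : X := to x0 (gamma r)^-1%g.

End Action.

(* Main.v *)
(* Moving by gamma r carries r to some x i, so d(x0 (gamma r)^-1, r) = d(x0, x i),
   which is the distance between the orbits of x0 and x i; any other codeword
   c is carried to c (gamma r), still in the orbit of x0. *)
Require Import Defs.
From mathcomp Require Import all_boot all_order all_fingroup all_algebra.
From mathcomp Require Import filter topology_structure uniform_structure.
From mathcomp Require Import reals pseudometric_structure metric_structure.

Theorem theorem8 (R : realType) (X : finMetricType R) (G : finGroupType)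
    (to : {action G &-> X}) (to_isom : acts_by_isometries to)
    (l : nat) (x : 'I_l.+1 -> X) (x_inj : injective x)
    (x_transversal :
      is_transversal [set x i | i : 'I_l.+1] (orbit_set to) [set: X])
    (x0_closest : forall i : 'I_l.+1, i != ord0 ->
      set_mdist (orbit to [set: G] (x ord0)) (orbit to [set: G] (x i))
      = mdist (x ord0) (x i))
    (gamma : X -> G) (gamma_canon : canonizing to [set x i | i : 'I_l.+1] gamma) :
  min_distance_decoder (orbit_code to (x ord0)) (dec to (x ord0) gamma).
Proof.
move=> r; split=> [|c c_code]; first exact: mem_orbit (in_setT _).
have /imsetP[i _ r_canon] := gamma_canon r.
(* Both distances are moved by the same [gamma r], which cancels the inverse in [dec]; what remains
   is to compare [x ord0] and [to c (gamma r)] by their distance to [x i]. *)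
rewrite -(to_isom _ r (gamma r)) -(to_isom c r (gamma r)) r_canon /dec actKV.
(* [x0_closest] is silent at [ord0]; there [r] is itself a codeword and the left side is 0. *)
have [->|i_neq0] := eqVneq i ord0; first by rewrite mdistxx mdist_ge0.
(* As a distance between orbits, the left side bounds the distance of every pair taken from them, in
   particular [to c (gamma r)] and [x i]. *)
rewrite -(x0_closest i i_neq0); apply: set_mdist_le; last exact: orbit_refl.
by rewrite (orbit_actr to (G := [set: G]%G)) ?in_setT.
Qed.
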